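(* Let $P$ be the set of centers of tiles of one of the regular tilings $\mathcal{T}\in\{(4^4),(6^3),(3^6)\}$ (positioned as in the context), let $\varphi_\alpha(z)=\exp(2\pi i z/\alpha)$ with $\alpha$ admissible for $\mathcal{T}$, and let $\mathcal{S}_\alpha=\{\varphi_\alpha(T): T\in\mathcal{T}\}$ and $Q_\alpha=\{\varphi_\alpha(t): t\in P\}$. There is an upper bound $M$, valid for every ideal coloring $\mathcal{C}_P$ of $P$ that is compatible with $\varphi_\alpha$, for the number of colors in the coloring $\varphi_\alpha(\mathcal{C}_P)$ of $Q_\alpha$. In particular, (a) if $\mathcal{T}$ is the $(4^4)$ or $(6^3)$ tiling, then $M=|\alpha|^2$; (b) if $\mathcal{T}$ is the $(3^6)$ tiling, then $M=|\alpha|^2$ if $\alpha\notin P_0=(2+\omega)$ and $M=\frac23|\alpha|^2$ if $\alpha\in P_0$. Moreover, there exists a coloring of $Q_\alpha$, of the form $\varphi_\alpha(\mathcal{C}_P)$ for some ideal coloring $\mathcal{C}_P$ of $P$ compatible with $\varphi_\alpha$, that has exactly $M$ colors and whose colors are permuted by the elements of $\mathrm{S}(\mathcal{S}_\alpha)$.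
   Context: The plane is identified with $\mathbb{C}$, $\mathbb{C}^*=\mathbb{C}\setminus\{0\}$, $i=\sqrt{-1}$, $\omega=e^{2\pi i/3}$. The regular tilings are positioned as follows; $P$ is the set of centers of the tiles and $\Lambda$ the orbit of $0$ under the group of translations preserving $\mathcal{T}$. $(4^4)$: unit squares with $P=\mathbb{Z}[i]$; $\Lambda=\mathbb{Z}[i]$. $(6^3)$: regular hexagons with $P=\mathbb{Z}[\omega]$; $\Lambda=\mathbb{Z}[\omega]$. $(3^6)$: equilateral triangles whose set of vertices is the ideal $P_0=(2+\omega)$ of $\mathbb{Z}[\omega]$ (side length $\sqrt3$); $P=\mathbb{Z}[\omega]\setminus P_0$ and $\Lambda=P_0$. Put $\xi=i$ for $(4^4)$ and $\xi=\omega$ for $(6^3)$ and $(3^6)$. A number $\alpha\in\mathbb{C}^*$ is admissible for $\mathcal{T}$ if $\alpha\in\Lambda$ and $|\alpha|>\max\{|z_1-z_2| : z_1,z_2\in\partial T,\ T\in\mathcal{T}\}$; in that case $\mathcal{S}_\alpha$ is a tiling of $\mathbb{C}^*$. For a set $X$ of points or tiles, $\mathrm{S}(X)$ is the group of isometries of the plane mapping $X$ onto itself. One has $\mathrm{S}(\mathcal{S}_\alpha)\subseteq\mathrm{S}(Q_\alpha)$. A coloring of a set $X$ is a partition of $X$ into finitely many nonempty classes (colors); the number of colors is the number of classes. An element $h\in\mathrm{S}(X)$ permutes the colors if it maps each class onto a class. For a nonzero ideal $(\beta)$ of $\mathbb{Z}[\xi]$, the coloring of $\mathbb{Z}[\xi]$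 induced by $(\beta)$ is the partition $\{X_i\}_{i=1}^m$ into cosets of $(\beta)$, and the coloring of $P$ induced by $(\beta)$ is $\{X_i\cap P: X_i\cap P\ne\varnothing\}$; such colorings of $P$ are called ideal colorings. A coloring $\{Y_j\}$ of $P$ is compatible with $\varphi_\alpha$ if $\{\varphi_\alpha(Y_j)\}$ is a coloring of $Q_\alpha$ in the sense that each point receives exactly one color, i.e. $\varphi_\alpha(Y_j)\cap\varphi_\alpha(Y_k)=\varnothing$ for $j\neq k$; the resulting coloring of $Q_\alpha$ is denoted $\varphi_\alpha(\mathcal{C}_P)$. *)

(* Defs.v *)
From HB Require Import structures.
From mathcomp Require Import all_boot all_order all_algebra finmap.
From mathcomp Require Import all_classical all_reals all_analysis.
From mathcomp Require Import complex.

Set Implicit Arguments.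
Unset Strict Implicit.
Unset Printing Implicit Defensive.

Import Order.TTheory GRing.Theory Num.Theory ComplexField.Normc.
Import numFieldNormedType.Exports.

Local Open Scope classical_set_scope.
Local Open Scope ring_scope.
Local Open Scope complex_scope.

(* The plane is R[i]; lengths are the real numbers normc z = |z|. *)

(* The regular tilings (4^4), (6^3), (3^6) by squares, hexagons, triangles. *)
Inductive tiling := T44 | T63 | T36.

Section Plane.
Context {R : realType}.
Local Notation C := R[i].
Implicit Types (T : tiling) (alpha z : C) (X : set C) (K : set (set C)).

Definition cexp z : C :=
  (expR (complex.Re z))%:C * (cos (complex.Im z) +i* sin (complex.Im z)).

Definition omega : C := cexp (0 +i* (2 * pi / 3)).

Definition xi T : C := if T is T44 then 'i else omega.

(* Z[x], for x a quadratic integer. *)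
Definition Zadj (x : C) : set C :=
  [set z | exists a b : int, z = a%:~R + b%:~R * x].

Definition Zxi T : set C := Zadj (xi T).

Definition ideal T (beta : C) : set C := [set beta * w | w in Zxi T].

Definition P0 : set C := [set (2 + omega) * w | w in Zadj omega].

Definition centers T : set C :=
  match T with
  | T44 => Zadj 'i
  | T63 => Zadj omega
  | T36 => Zadj omega `\` P0
  end.

Definition Lambda T : set C :=
  match T with
  | T44 => Zadj 'i
  | T63 => Zadj omega
  | T36 => P0
  end.

(* The closed regular n-gon with center c having v as one of its vertices, as
   the convex hull of the points c + exp(2 k pi i / n) (v - c). *)
Definition ngon (n : nat) (c v : C) : set C :=
  [set z | exists t : 'I_n -> R,
    [/\ forall k, 0 <= t k, \sum_k t k = 1 &
        z = \sum_k (t k)%:C *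
              (c + cexp (0 +i* (2 * pi / n%:R)) ^+ k * (v - c))]].

(* Squares: sides parallel to the axes and of length 1.  Hexagons: 2 + omega
   is sqrt 3 * exp(pi i / 6), so one vertex of the tile centered at c is at
   distance 1 / sqrt 3 in the direction exp(- pi i / 6), midway between the
   directions of two neighbors of c in Z[omega].  Triangles: the vertices are
   the points of P0 at distance 1 from the center, so the side is sqrt 3. *)
Definition tiles T : set (set C) :=
  match T with
  | T44 => [set ngon 4 c (c + (1 + 'i) / 2) | c in centers T44]
  | T63 => [set ngon 6 c (c + (2 + omega)^-1) | c in centers T63]
  | T36 => [set X | exists c v,
             [/\ centers T36 c, P0 v, normc (v - c) = 1 & X = ngon 3 c v]]
  end.

Definition boundary X : set C :=
  closure (X : set C^o) `\` interior (X : set C^o).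

Definition boundary_distances T : set R :=
  [set d | exists X z1 z2, [/\ tiles T X, boundary X z1, boundary X z2 &
                               d = normc (z1 - z2)]].

Definition is_max (A : set R) (m : R) : Prop := A m /\ ubound A m.

Definition admissible T alpha : Prop :=
  [/\ alpha != 0, Lambda T alpha &
      exists2 m, is_max (boundary_distances T) m & m < normc alpha].

Definition phi alpha z : C := cexp ((2 * pi)%:C * 'i * z / alpha).

Definition S_ T alpha : set (set C) := [set phi alpha @` X | X in tiles T].

Definition Q_ T alpha : set C := phi alpha @` centers T.

Definition isometry (h : C -> C) : Prop :=
  forall x y, normc (h x - h y) = normc (x - y).

Definition symmetry_points X (h : C -> C) : Prop :=
  isometry h /\ h @` X = X.

Definition symmetry_tiles (S : set (set C)) (h : C -> C) : Prop :=
  isometry h /\ [set h @` X | X in S] = S.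

(* A coloring is given by the set K of its classes. *)
Definition coloring X K : Prop := finite_set K /\ partition K id X.

(* fset_set is only meaningful on finite sets. *)
Definition num_colors K : nat := #|` fset_set K|.

Definition permutes_colors X K (h : C -> C) : Prop :=
  symmetry_points X h /\ forall Y, K Y -> K (h @` Y).

Definition cosets T (beta : C) : set (set C) :=
  [set [set z + w | w in ideal T beta] | z in Zxi T].

Definition induced_coloring T (beta : C) : set (set C) :=
  [set Y | Y !=set0 /\ exists2 X, cosets T beta X & Y = X `&` centers T].

Definition ideal_coloring T K : Prop :=
  exists beta, [/\ Zxi T beta, beta != 0 & K = induced_coloring T beta].

(* phi alpha sends distinct classes to disjoint sets. *)
Definition compatible alpha K : Prop := trivIset K (image^~ (phi alpha)).

Definition image_coloring alpha K : set (set C) :=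
  [set phi alpha @` Y | Y in K].

End Plane.

(* Main.v *)
(* Writing phi for phi_alpha, phi z = phi w iff z - w is an integer multiple of
   alpha, so the coloring induced by (beta) is compatible with phi iff beta
   divides alpha.  The number of colors is the number of cosets of (beta) that
   meet P: the norm of beta, or 2/3 of it if P omits P0 and beta lies in P0.
   Hence the maximum is reached for beta = alpha; note that if alpha lies in P0
   and beta does not, then the norm of beta is at most half that of alpha.
   A symmetry h of S_alpha fixes 0, since only near 0 are the tiles arbitrarily
   small; so it is a rotation or a reflection, and h o phi = phi o H for H the
   composition of a translation with the identity or with a reflection that
   preserves the lattice generated by alpha.  As |alpha| exceeds the diameters
   of the tiles, H maps every tile into a translate of a tile by a multiple of
   alpha, and comparing circumcenters shows that H maps P onto P.  Finally
   H(z + (alpha)) = H(z) + (alpha), so that H permutes the classes. *)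
Require Import Defs.
From mathcomp Require Import all_boot all_order all_algebra finmap.
From mathcomp Require Import all_classical all_reals all_analysis.
From mathcomp Require Import complex.
From mathcomp Require Import zify ring lra.
Import Order.TTheory GRing.Theory Num.Theory ComplexField.Normc.
Local Open Scope classical_set_scope.
Local Open Scope ring_scope.
Local Open Scope complex_scope.

Set Implicit Arguments.
Unset Strict Implicit.

(** * Complex modulus and exponential *)

Section Complex.
Context {R : realType}.
Local Notation C := R[i].
(* The notation x^* is ambiguous: it may be read as Num.conj. *)
Local Notation cj := (@conjc R).
Implicit Types (z w u : C).

Lemma normc_sqr z : normc z ^+ 2 = complex.Re z ^+ 2 + complex.Im z ^+ 2.
Proof. by case: z => a b /=; rewrite sqr_sqrtr // addr_ge0 ?sqr_ge0. Qed.

Lemma normc_ge0 z : 0 <= normc z.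
Proof. by case: z => a b; apply: sqrtr_ge0. Qed.

Lemma normc_gt0 z : (0 < normc z) = (z != 0).
Proof.
rewrite lt_def normc_ge0 andbT; congr (~~ _).
by apply/eqP/eqP => [/eq0_normc//|->]; rewrite normc0.
Qed.

Lemma normc_real (x : R) : normc x%:C = `|x|.
Proof. by rewrite /normc /= expr0n addr0 sqrtr_sqr. Qed.

Lemma normr_normc z : `|z| = (normc z)%:C.
Proof. by case: z => a b; rewrite normc_def. Qed.

Lemma normc_sqr_conj z : (normc z ^+ 2)%:C = z * cj z.
Proof. by case: z => a b; rewrite normc_sqr; simpc; congr (_ +i* _); ring. Qed.

Lemma normc_conj z : normc (cj z) = normc z.
Proof. by case: z => a b /=; rewrite sqrrN. Qed.

Lemma conjcD z w : cj (z + w) = cj z + cj w.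
Proof. by case: z w => [a b] [c d]; simpc; congr (_ +i* _); ring. Qed.

Lemma conjcM z w : cj (z * w) = cj z * cj w.
Proof. by case: z w => [a b] [c d]; simpc; congr (_ +i* _); ring. Qed.

Lemma conjcN z : cj (- z) = - cj z.
Proof. by case: z => a b; simpc. Qed.

Lemma conjcB z w : cj (z - w) = cj z - cj w.
Proof. by rewrite conjcD conjcN. Qed.

Lemma normcB z w : normc (z - w) = normc (w - z).
Proof. by rewrite -opprB normcN. Qed.

Lemma natrC (n : nat) : (n%:R : R)%:C = n%:R :> C.
Proof. exact: rmorph_nat. Qed.

Lemma intrC (n : int) : (n%:~R : R)%:C = n%:~R :> C.
Proof. exact: rmorph_int. Qed.

Lemma conjc_int (n : int) : cj (n%:~R : C) = n%:~R.
Proof. by rewrite -intrC conjc_real. Qed.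

Lemma normc_intr (n : int) : normc (n%:~R : C) = `|n%:~R|.
Proof. by rewrite -intrC normc_real. Qed.

Lemma normcX z n : normc (z ^+ n) = normc z ^+ n.
Proof. by elim: n => [|n IH]; rewrite ?expr0 ?normc1 // !exprS normcM IH. Qed.

Lemma cexpD z w : cexp (z + w) = cexp z * cexp w.
Proof.
case: z w => [a b] [c d]; rewrite /cexp /= expRD cosD sinD; simpc.
by congr (_ +i* _); ring.
Qed.

Lemma cexp0 : cexp (0 : C) = 1.
Proof. by rewrite /cexp /= expR0 cos0 sin0; simpc. Qed.

Lemma cexp_conj z : cexp (cj z) = cj (cexp z).
Proof. by case: z => a b; rewrite /cexp /= cosN sinN; simpc. Qed.

Lemma normc_cexp z : normc (cexp z) = expR (complex.Re z).
Proof.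
rewrite /cexp normcM normc_real ger0_norm ?expR_ge0 // /normc.
by rewrite cos2Dsin2 sqrtr1 mulr1.
Qed.

Lemma cexp_neq0 z : cexp z != 0.
Proof. by rewrite -normc_gt0 normc_cexp expR_gt0. Qed.

Lemma cexpMn z n : cexp (z *+ n) = cexp z ^+ n.
Proof. by elim: n => [|n IH]; rewrite ?mulr0n ?cexp0 // mulrSr exprSr cexpD IH. Qed.

Lemma cexp_surj_circle u : normc u = 1 -> exists t : R, u = cexp (0 +i* t).
Proof.
move=> u1; have := normc_sqr u; rewrite u1 expr1n.
case: u u1 => x y _ /= xy1.
have x11 : -1 <= x <= 1 by nra.
have [y0|y0] := leP 0 y.
  exists (acos x); rewrite /cexp /= expR0 mul1r acosK ?in_itv //= sin_acos //.
  by rewrite xy1 addrAC subrr add0r sqrtr_sqr ger0_norm.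
exists (- acos x); rewrite /cexp /= expR0 mul1r cosN acosK ?in_itv //= sinN sin_acos //.
by rewrite xy1 addrAC subrr add0r sqrtr_sqr ltr0_norm // opprK.
Qed.

Lemma cexp_periodic (n : int) : cexp (0 +i* (2 * pi * n%:~R) : C) = 1.
Proof.
have nat_case (k : nat) : cexp (0 +i* (2 * pi * k%:R) : C) = 1.
  have -> : 0 +i* (2 * pi * k%:R) = (0 +i* (2 * pi)) *+ k :> C.
    by rewrite -[RHS]mulr_natr -natrC; simpc.
  rewrite cexpMn; suff -> : cexp (0 +i* (2 * pi) : C) = 1 by rewrite expr1n.
  by rewrite /cexp /= mulr2n mulrDl mul1r -mulr2n cos2pi sin2pi expR0; simpc.
case: n => n; first exact: nat_case.
rewrite NegzE mulrNz mulrN; apply: (mulIf (cexp_neq0 (0 +i* (2 * pi * n.+1%:R)))).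
rewrite -cexpD nat_case mulr1; simpc.
by rewrite addNr cexp0.
Qed.

Lemma cexp_eq1 z : cexp z = 1 -> exists n : int, z = 0 +i* (2 * pi * n%:~R).
Proof.
case: z => a b e1; have : normc (cexp (a +i* b)) = 1 by rewrite e1 normc1.
rewrite normc_cexp /= => /(congr1 (@ln R)); rewrite expRK ln1 => a0; rewrite {}a0 in e1 *.
have pi2 : 0 < 2 * pi :> R by rewrite mulr_gt0 ?pi_gt0.
set n := Num.floor (b / (2 * pi)); exists n; congr (_ +i* _).
have /andP[nl nu] := floor_itv (b / (2 * pi)); rewrite -/n in nl nu.
set c := b - 2 * pi * n%:~R.
have c0 : 0 <= c by rewrite subr_ge0 mulrC -ler_pdivlMr.
have c1 : c < 2 * pi.
  by rewrite ltrBlDl; move: nu; rewrite ltr_pdivrMr // intrD mulrDl mul1r mulrC.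
have : cexp (0 +i* c : C) = 1.
  apply: (mulIf (cexp_neq0 (0 +i* (2 * pi * n%:~R)))).
  by rewrite -cexpD cexp_periodic mulr1 -[RHS]e1; simpc; rewrite subrK.
rewrite /cexp /= expR0 mul1r => -[cc _].
suff : c = 0 by move/eqP; rewrite subr_eq0 => /eqP.
have pig := @pi_ge0 R.
(* [cos] is injective only on $[0,\pi]$. Beyond $\pi$ the argument is applied to $2\pi - c$, whose
   vanishing would contradict $c < 2\pi$. *)
have [cpi|cpi] := leP c pi.
  by apply: cos_inj; rewrite ?cos0 // in_itv /= ?lexx ?c0 ?cpi ?pig.
have : 2 * pi - c = 0.
  apply: cos_inj; rewrite ?in_itv /= ?lexx ?pig //; first by apply/andP; split; lra.
  by rewrite cos0 (_ : 2 * pi - c = - c + pi *+ 2) ?cosD2pi ?cosN //; ring.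
by move=> e; move: c1; rewrite (subr0_eq e) ltxx.
Qed.

Lemma cexp_im_eq1 (t : R) : 0 < t < 2 * pi -> cexp (0 +i* t : C) != 1.
Proof.
move=> /andP[t0 t1]; apply/eqP => /cexp_eq1 [n] [tn].
have pi2 : 0 < 2 * pi :> R by rewrite mulr_gt0 ?pi_gt0.
move: t0 t1; rewrite tn pmulr_rgt0 // gtr_pMr //.
by rewrite ltr0z ltrz1; lia.
Qed.

End Complex.

(** * Quadratic integers *)

Section QuadraticIntegers.
Context {R : realType}.
Local Notation C := R[i].
Local Notation cj := (@conjc R).
Implicit Types (x z w u beta : C) (a b s : int).

(* Covers both x = i (s = 0) and x = omega (s = 1). *)
Definition quadratic_unit (s : int) (x : C) : Prop :=
  [/\ x ^+ 2 = - 1 - s%:~R * x, cj x = - s%:~R - x & 0 < complex.Im x].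

Lemma Zadj_int x a : Zadj x a%:~R.
Proof. by exists a, 0; rewrite mul0r addr0. Qed.

Lemma Zadj0 x : Zadj x 0.
Proof. exact: (Zadj_int x 0). Qed.

Lemma Zadj1 x : Zadj x 1.
Proof. exact: (Zadj_int x 1). Qed.

Lemma Zadj_gen x : Zadj x x.
Proof. by exists 0, 1; rewrite mul1r add0r. Qed.

Lemma ZadjD x z w : Zadj x z -> Zadj x w -> Zadj x (z + w).
Proof.
by move=> [a [b ->]] [c [d ->]]; exists (a + c), (b + d); ring.
Qed.

Lemma ZadjN x z : Zadj x z -> Zadj x (- z).
Proof. by move=> [a [b ->]]; exists (- a), (- b); ring. Qed.

Lemma ZadjB x z w : Zadj x z -> Zadj x w -> Zadj x (z - w).
Proof. by move=> zx wx; apply: ZadjD => //; apply: ZadjN. Qed.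

Section Quad.
Variables (s : int) (x : C).
Hypothesis quadx : quadratic_unit s x.

Lemma quad_mul a b c d :
  (a%:~R + b%:~R * x) * (c%:~R + d%:~R * x) =
  (a * c - b * d)%:~R + (a * d + b * (c - s * d))%:~R * x.
Proof.
case: quadx => x2 _ _.
transitivity (a%:~R * c%:~R + (a%:~R * d%:~R + b%:~R * c%:~R) * x
  + b%:~R * d%:~R * x ^+ 2); first by ring.
by rewrite x2; ring.
Qed.

Lemma ZadjM z w : Zadj x z -> Zadj x w -> Zadj x (z * w).
Proof. by move=> [a [b ->]] [c [d ->]]; rewrite quad_mul; do 2!eexists. Qed.

Lemma Zadj_conj z : Zadj x z -> Zadj x (cj z).
Proof.
case: quadx => _ xJ _ [a [b ->]]; exists (a - s * b), (- b).
by rewrite conjcD conjcM !conjc_int xJ; ring.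
Qed.

Lemma quad_norm a b :
  normc (a%:~R + b%:~R * x) ^+ 2 = (a ^+ 2 - s * a * b + b ^+ 2)%:~R.
Proof.
apply: (@complexI R); rewrite normc_sqr_conj intrC.
case: quadx => x2 xJ _; rewrite conjcD conjcM !conjc_int xJ.
transitivity (a%:~R ^+ 2 - s%:~R * a%:~R * b%:~R - b%:~R ^+ 2 * (x ^+ 2 + s%:~R * x)).
  by ring.
by rewrite x2; ring.
Qed.

Lemma quad_inj a b c d :
  a%:~R + b%:~R * x = c%:~R + d%:~R * x -> (a = c) * (b = d).
Proof.
case: quadx => _ _; case: x => x1 x2 /= x2gt0.
rewrite -!intrC; simpc => -[e1 e2].
have /eqP := e2; rewrite -subr_eq0 -mulrBl mulf_eq0 (gt_eqF x2gt0) orbF.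
rewrite subr_eq0 eqr_int => /eqP bd; split=> //.
by move: e1; rewrite bd => /addIr/eqP; rewrite eqr_int => /eqP.
Qed.

(** Integrality creates gaps between norms: a nonzero element has norm at least 1, and if the norm
    is not 1 it is at least 2. *)
Lemma Zadj_norm z : Zadj x z -> exists n : nat, normc z ^+ 2 = n%:R.
Proof.
move=> [a [b ->]]; rewrite quad_norm.
have : 0 <= ((a ^+ 2 - s * a * b + b ^+ 2)%:~R : R) by rewrite -quad_norm sqr_ge0.
by rewrite ler0z; case: (_ + _) => // n _; exists n.
Qed.

Lemma Zadj_norm_ge1 z : Zadj x z -> z != 0 -> 1 <= normc z ^+ 2.
Proof.
move=> zx; rewrite -normc_gt0 => /(exprn_gt0 2).
by have [n ->] := Zadj_norm zx; rewrite ltr0n ler1n.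
Qed.

End Quad.
End QuadraticIntegers.

(** * The index of a principal ideal *)

Section IdealIndex.
Context {R : realType}.
Local Notation C := R[i].
Implicit Types (x z w u beta : C) (a b s : int).

(* Hermite normal form of the lattice (beta), beta = a + b x: it is spanned by
   D and e + g x, with g = gcd(a, b) and g D the norm of beta. *)
Lemma ideal_hermite s a b : a ^+ 2 - s * a * b + b ^+ 2 != 0 ->
  exists g e D : int, [/\ 0 < g, D != 0, g * D = a ^+ 2 - s * a * b + b ^+ 2 &
    forall X Y : int, (exists p q : int, X = a * p - b * q /\ Y = a * q + b * (p - s * q)) <->
      ((g %| Y) && (D %| X - e * (Y %/ g)%Z))%Z].
Proof.
move=> N0; set c := a - s * b.
(* The second coordinate of $(a + bx)(p + qx)$ is $bp + cq$, so the second coordinates in the ideal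
   are the multiples of $g = \gcd(b, c)$, and $p_0 + q_0 x$ yields $g$ itself. *)
have [p0 [q0 bez]] := Bezoutz b c; set g := gcdz b c in bez.
have [b1 bE] : exists b1, b = b1 * g by apply/dvdzP; apply: dvdz_gcdl.
have [c1 cE] : exists c1, c = c1 * g by apply/dvdzP; apply: dvdz_gcdr.
have NE : a ^+ 2 - s * a * b + b ^+ 2 = g * (c1 * a + b1 * b).
  transitivity (c * a + b * b); first by rewrite /c; ring.
  have -> : c * a = c1 * g * a by rewrite -cE.
  have -> : b * b = b1 * g * b by rewrite -bE.
  by ring.
have gge0 : 0 <= g by [].
clearbody g.
have g0 : g != 0 by apply: contraNneq N0 => g0; rewrite NE g0 mul0r.
have bez1 : p0 * b1 + q0 * c1 = 1.
  by apply: (mulIf g0); rewrite mul1r -[RHS]bez bE cE; ring.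
have aE : a = (c1 + s * b1) * g by rewrite mulrDl -mulrA -bE -cE /c; ring.
(* The product of $a + bx$ with $p_0 + q_0 x$ is $e + gx$, and its product with $c_1 - b_1 x$ is the
   integer $D$. These two elements span the ideal. *)
exists g, (a * p0 - b * q0), (c1 * a + b1 * b); split.
- by rewrite lt_def g0.
- by apply: contraNneq N0 => D0; rewrite NE D0 mulr0.
- by rewrite NE.
move=> X Y; split=> [[p [q [-> ->]]]|].
  have -> : a * q + b * (p - s * q) = (p * b1 + q * c1) * g.
    by rewrite {1}aE {1}bE; ring.
  rewrite dvdz_mull ?dvdzz // mulzK //=.
  apply/dvdzP; exists (q0 * p - p0 * q).
  transitivity (a * (p - p0 * (p * b1 + q * c1)) - b * (q - q0 * (p * b1 + q * c1))).
    by ring.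
  have -> : p - p0 * (p * b1 + q * c1) = c1 * (q0 * p - p0 * q).
    by rewrite -{1}[p]mul1r -bez1; ring.
  have -> : q - q0 * (p * b1 + q * c1) = - b1 * (q0 * p - p0 * q).
    by rewrite -{1}[q]mul1r -bez1; ring.
  by ring.
case/andP=> /dvdzP[y ->]; rewrite mulzK // => /dvdzP[k Xk].
exists (p0 * y + k * c1), (q0 * y - k * b1); split.
  by rewrite -[LHS](subrK ((a * p0 - b * q0) * y)) Xk; ring.
have -> : a * (q0 * y - k * b1) + b * (p0 * y + k * c1 - s * (q0 * y - k * b1)) =
   (p0 * b + q0 * c) * y + k * (b * c1 - b1 * c) by rewrite /c; ring.
have -> : b * c1 - b1 * c = 0 by rewrite {1}bE cE; ring.
by rewrite bez; ring.
Qed.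

Lemma modz_sub_eq (m n d : int) : ((m %% d)%Z == (n %% d)%Z) = (d %| m - n)%Z.
Proof. by rewrite -eqz_mod_dvd. Qed.

Variables (s : int) (x : C).
Hypothesis quadx : quadratic_unit s x.

(** By the Hermite form, each coset of $(\beta)$ has a unique representative $r + qx$ with $0 \le r
    < D$ and $0 \le q < g$. The map [f] numbers the coset by $qD + r$, so counting colors becomes
    counting values of [f]. *)
Lemma norm_index beta : Zadj x beta -> beta != 0 ->
  exists (f : C -> nat) (N : nat),
    [/\ normc beta ^+ 2 = N%:R, f @` Zadj x = `I_N &
        forall z w, Zadj x z -> Zadj x w ->
          f z = f w <-> exists2 u, Zadj x u & z - w = beta * u].
Proof.
move=> [a [b betaE]] beta0.
have normE := quad_norm quadx a b; rewrite -betaE in normE.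
have Ngt0 : 0 < a ^+ 2 - s * a * b + b ^+ 2.
  by rewrite -(ltr_int R) -normE exprn_gt0 // normc_gt0.
have N0 : a ^+ 2 - s * a * b + b ^+ 2 != 0 by rewrite gt_eqF.
have [g [e [D [g0 D0 gD idP]]]] := ideal_hermite N0.
have gn0 : g != 0 by rewrite gt_eqF.
have Dgt0 : 0 < D by rewrite -(pmulr_rgt0 _ g0) gD.
(* Coordinates in the basis $(1, x)$; the default $(0, 0)$ is taken only outside $\mathbb{Z}[x]$. *)
pose crd (z : C) := xget (0, 0) [set p : int * int | z = p.1%:~R + p.2%:~R * x].
have crdE X Y : crd (X%:~R + Y%:~R * x) = (X, Y).
  rewrite /crd; case: xgetP => [[X' Y'] _ /= /(quad_inj quadx)[-> ->]//|].
  by move=> /(_ (X, Y)); case.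
pose f2 (p : int * int) :=
  `|((p.2 %% g)%Z * D + ((p.1 - e * (p.2 %/ g)%Z) %% D)%Z)%R|%N.
exists (fun z => f2 (crd z)), `|(a ^+ 2 - s * a * b + b ^+ 2)%R|%N; split.
- by rewrite normE -[in LHS](gtz0_abs Ngt0).
- rewrite -gD; apply/seteqP; split => [_ [z [X [Y ->]] <-]|n /=].
    rewrite crdE /f2 /=.
    have := modz_ge0 Y gn0; have := ltz_pmod Y g0.
    have := modz_ge0 (X - e * (Y %/ g)%Z) D0; have := ltz_pmod (X - e * (Y %/ g)%Z) Dgt0.
    set r := ((X - _) %% D)%Z; set q := (Y %% g)%Z => r1 r0 q1 q0.
    have qD : 0 <= q * D by rewrite mulr_ge0 // ltW.
    have : (q + 1) * D <= g * D by rewrite ler_pM2r //; lia.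
    rewrite mulrDl mul1r; move: r1 r0 qD; move: (q * D) (g * D) (r) => qD gD' r'.
    by clear; lia.
  move=> ng; pose q := (n %/ D)%Z; pose r := (n %% D)%Z.
  exists ((r)%:~R + q%:~R * x); first by exists r, q.
  rewrite crdE /f2 /=.
  have r1 := modz_ge0 n D0; have r2 := ltz_pmod n Dgt0; have nE := divz_eq n D.
  have q1 : 0 <= q by rewrite /q divz_ge0.
  have q2 : q < g.
    rewrite -(ltr_pM2r Dgt0); apply: le_lt_trans (_ : n%:Z < _).
      by rewrite nE lerDl.
    by move: ng; rewrite -ltz_nat gD gtz0_abs // -gD.
  have -> : (q %% g)%Z = q by rewrite modz_small // q1 q2.
  have -> : (q %/ g)%Z = 0 by rewrite divz_small // q1 gtz0_abs.
  rewrite mulr0 subr0 modz_small -?nE //.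
  by rewrite /r r1 r2.
move=> _ _ [X [Y ->]] [X' [Y' ->]]; rewrite !crdE.
have -> : X%:~R + Y%:~R * x - (X'%:~R + Y'%:~R * x) =
  (X - X')%:~R + (Y - Y')%:~R * x by ring.
have -> : (exists2 u, Zadj x u &
    (X - X')%:~R + (Y - Y')%:~R * x = beta * u) <->
  (exists p q : int, X - X' = a * p - b * q /\ Y - Y' = a * q + b * (p - s * q)).
  split=> [[_ [p [q ->]]]|[p [q [e1 e2]]]].
    rewrite betaE (quad_mul quadx) => eq; exists p, q.
    by have [-> ->] := quad_inj quadx eq.
  exists (p%:~R + q%:~R * x); first by exists p, q.
  by rewrite betaE (quad_mul quadx) -e1 -e2.
rewrite idP /f2 /=.
have q0 := modz_ge0 Y gn0; have q1 := ltz_pmod Y g0.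
have q0' := modz_ge0 Y' gn0; have q1' := ltz_pmod Y' g0.
have yE := divz_eq Y g; have yE' := divz_eq Y' g.
set y := (Y %/ g)%Z in yE *; set y' := (Y' %/ g)%Z in yE' *.
have r0 := modz_ge0 (X - e * y) D0; have r1 := ltz_pmod (X - e * y) Dgt0.
have r0' := modz_ge0 (X' - e * y') D0; have r1' := ltz_pmod (X' - e * y') Dgt0.
have key : (g %| Y - Y')%Z -> ((Y - Y') %/ g)%Z = y - y'.
  rewrite -modz_sub_eq => /eqP eY.
  have -> : Y - Y' = (y - y') * g by rewrite yE yE' eY; ring.
  by rewrite mulzK // gt_eqF.
split=> [ff|/andP[gY]].
  have [] : (Y %% g)%Z = (Y' %% g)%Z /\
      ((X - e * y) %% D)%Z = ((X' - e * y') %% D)%Z.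
    move: ff; move: ((X - _) %% D)%Z ((X' - _) %% D)%Z (Y %% g)%Z (Y' %% g)%Z
      q0 q0' r0 r1 r0' r1' => r r' q q' q0 q0' r0 r1 r0' r1' /(congr1 Posz).
    rewrite !gez0_abs ?addr_ge0 ?mulr_ge0 ?(ltW Dgt0) // => e2.
    (* Both remainders are below $D$, so division by $D$ separates the two digits of the code. *)
    have e1 : q = q'.
      have := congr1 (fun m => (m %/ D)%Z) e2.
      by rewrite /= !divzMDl // !divz_small ?addr0 ?r0 ?r0' ?gtz0_abs.
    by split=> //; move: e2; rewrite e1 => /addrI.
  move=> eq1 eq2.
  have gY : (g %| Y - Y')%Z by rewrite -modz_sub_eq eq1.
  rewrite gY /= key //.
  move/eqP: eq2; rewrite modz_sub_eq; congr (dvdz _ _); ring.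
rewrite key // => dX.
have -> : (Y %% g)%Z = (Y' %% g)%Z by apply/eqP; rewrite modz_sub_eq.
congr (absz (_ + _)); apply/eqP; rewrite modz_sub_eq.
by move: dX; congr (is_true (dvdz _ _)); ring.
Qed.

End IdealIndex.

(** * Regular polygons *)

Section Polygon.
Context {R : realType}.
Local Notation C := R[i].
Implicit Types (c v z w a : C).

Lemma sumrC n (t : 'I_n -> R) : (\sum_k t k)%:C = \sum_k (t k)%:C :> C.
Proof. by apply: (big_morph (real_complex R)) => [x y|]; simpc. Qed.

Lemma le_normc_sum n (F : 'I_n -> C) : normc (\sum_k F k) <= \sum_k normc (F k).
Proof.
elim/big_ind2: _ => [|z x w y zx wy|//]; first by rewrite normc0.
exact: le_trans (le_normcD _ _) (lerD zx wy).
Qed.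

Definition nth_root n : C := cexp (0 +i* (2 * pi / n%:R)).

(** Convertible to the points in the body of [ngon], which makes [ngonE] hold by computation. *)
Definition vertex n c v (k : nat) : C := c + nth_root n ^+ k * (v - c).

Lemma nth_root_expn n : (0 < n)%N -> nth_root n ^+ n = 1.
Proof.
move=> n0; rewrite /nth_root -cexpMn -[RHS](@cexp_periodic R 1); congr cexp.
rewrite -[LHS]mulr_natr -natrC; simpc.
by rewrite divfK // pnatr_eq0 -lt0n.
Qed.

Lemma sum_nth_root n : (1 < n)%N -> \sum_(k < n) nth_root n ^+ k = 0.
Proof.
move=> n1; have n0 : (0 < n)%N by apply: ltnW.
have root1 : nth_root n != 1.
  have n0R : 0 < n%:R :> R by rewrite ltr0n.
  have pi2 : 0 < 2 * pi :> R by rewrite mulr_gt0 ?pi_gt0.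
  apply: cexp_im_eq1; rewrite divr_gt0 //= ltr_pdivrMr // ltr_pMr //.
  by rewrite ltr1n.
have := subrX1 (nth_root n) n; rewrite nth_root_expn // subrr => /esym/eqP.
by rewrite mulf_eq0 subr_eq0 (negPf root1) => /eqP.
Qed.

Lemma normc_nth_root n k : normc (nth_root n ^+ k) = 1.
Proof. by rewrite normcX normc_cexp /= expR0 expr1n. Qed.

Lemma normc_vertex n c v k : normc (vertex n c v k - c) = normc (v - c).
Proof. by rewrite /vertex addrAC subrr add0r normcM normc_nth_root mul1r. Qed.

Lemma sum_vertex n c v : (1 < n)%N -> \sum_(k < n) (vertex n c v k - c) = 0.
Proof.
move=> n1; under eq_bigr do rewrite /vertex addrAC subrr add0r.
by rewrite -mulr_suml sum_nth_root // mul0r.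
Qed.

Lemma ngonE n c v z : ngon n c v z <->
  exists t : 'I_n -> R, [/\ forall k, 0 <= t k, \sum_k t k = 1 &
    z = \sum_k (t k)%:C * vertex n c v k].
Proof. by []. Qed.

Lemma ngon_vertex n c v (k : 'I_n) : ngon n c v (vertex n c v k).
Proof.
apply/ngonE; exists (fun j => (j == k)%:R); split=> [j||].
- exact: ler0n.
- by rewrite (bigD1 k) //= eqxx big1 ?addr0 // => j /negPf ->.
- rewrite (bigD1 k) //= eqxx mul1r big1 ?addr0 // => j /negPf ->.
  by rewrite mul0r.
Qed.

Lemma ngon_segment n c v z w (t : R) : 0 <= t <= 1 ->
  ngon n c v z -> ngon n c v w -> ngon n c v (z + t%:C * (w - z)).
Proof.
move=> /andP[t0 t1] [p [p0 p1 ->]] [q [q0 q1 ->]].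
exists (fun k => p k + t * (q k - p k)); split=> [k||].
- have -> : p k + t * (q k - p k) = (1 - t) * p k + t * q k by ring.
  by rewrite addr_ge0 // mulr_ge0 // subr_ge0.
- by rewrite big_split /= -mulr_sumr sumrB p1 q1 subrr mulr0 addr0.
- rewrite -sumrB mulr_sumr -big_split /=; apply: eq_bigr => k _.
  have -> : (p k + t * (q k - p k))%:C = (p k)%:C + t%:C * ((q k)%:C - (p k)%:C) :> C.
    by simpc.
  by ring.
Qed.

Lemma ngon_center n c v : (1 < n)%N -> ngon n c v c.
Proof.
move=> n1; have n0 : n%:R != 0 :> R by rewrite pnatr_eq0 -lt0n ltnW.
have sum1 : \sum_(k < n) (n%:R^-1 : R) = 1.
  by rewrite sumr_const card_ord -[LHS]mulr_natr mulVf.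
apply/ngonE; exists (fun=> n%:R^-1); split=> //.
have -> : \sum_(k < n) (n%:R^-1 : R)%:C * vertex n c v k =
  \sum_(k < n) (n%:R^-1 : R)%:C * c +
  (n%:R^-1 : R)%:C * \sum_(k < n) (vertex n c v k - c).
  by rewrite mulr_sumr -big_split; apply: eq_bigr => k _ /=; ring.
by rewrite sum_vertex // mulr0 addr0 -mulr_suml -sumrC sum1 mul1r.
Qed.

(** The distance to a fixed point is convex, so its bound at the vertices extends to their convex
    hull. *)
Lemma ngon_le n c v w z (m : R) : ngon n c v z ->
  (forall k : 'I_n, normc (vertex n c v k - w) <= m) -> normc (z - w) <= m.
Proof.
move=> /ngonE[t [t0 t1 ->]] le_m.
have -> : \sum_k (t k)%:C * vertex n c v k - w =
    \sum_k (t k)%:C * (vertex n c v k - w).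
  under [RHS]eq_bigr do rewrite mulrBr.
  by rewrite sumrB -mulr_suml -sumrC t1 mul1r.
apply: le_trans (le_normc_sum _) _; rewrite -[leRHS]mul1r -t1 mulr_suml.
apply: ler_sum => k _; rewrite normcM normc_real ger0_norm //.
by rewrite ler_wpM2l.
Qed.

Lemma ngon_radius n c v z : ngon n c v z -> normc (z - c) <= normc (v - c).
Proof. by move=> /ngon_le; apply=> k; rewrite normc_vertex. Qed.

Lemma ngon_diam n c v z w (m : R) :
  (forall j k : 'I_n, normc (vertex n c v j - vertex n c v k) <= m) ->
  ngon n c v z -> ngon n c v w -> normc (z - w) <= m.
Proof.
move=> le_m nz nw; apply: (ngon_le nz) => j; rewrite normcB.
exact: (ngon_le nw).
Qed.

Lemma ngon_translate n c v d z : ngon n c v z -> ngon n (c + d) (v + d) (z + d).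
Proof.
move=> /ngonE[t [t0 t1 ->]]; apply/ngonE; exists t; split=> //.
have -> : d = \sum_k (t k)%:C * d by rewrite -mulr_suml -sumrC t1 mul1r.
rewrite -big_split; apply: eq_bigr => k _ /=.
rewrite -mulr_suml -sumrC t1 mul1r /vertex opprD addrACA subrr addr0.
by rewrite -mulrDr addrAC.
Qed.

(** No point of the polygon is farther from $c$ than a vertex, so any outward push of a vertex
    leaves the polygon. This connects admissibility, which speaks of boundaries, with the
    vertices. *)
Lemma vertex_boundary n c v (k : 'I_n) : v != c ->
  boundary (ngon n c v) (vertex n c v k).
Proof.
move=> vc; have r0 : 0 < normc (v - c) by rewrite normc_gt0 subr_eq0.
split; first by apply: subset_closure; apply: ngon_vertex.
move=> /nbhs_ballP[e /= e0].
(* Radii of balls in [C] are themselves elements of [C]; positivity forces this one to be real. *)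
have eE : e = (complex.Re e)%:C by rewrite RRe_real // gtr0_real.
have {}e0 : 0 < complex.Re e by rewrite eE ltcR in e0.
set d := vertex n c v k - c.
have dr : normc d = normc (v - c) by apply: normc_vertex.
(* With this factor the displacement $t d$ has length $e/2$, so the pushed point stays in the
   ball. *)
pose t := complex.Re e / (2 * normc (v - c)).
have t0 : 0 < t by rewrite divr_gt0 // mulr_gt0.
move=> /(_ (vertex n c v k + t%:C * d)) [].
  rewrite /ball /= opprD addrA subrr add0r normrN normr_normc eE ltcR.
  rewrite normcM normc_real gtr0_norm // dr.
  rewrite /t -mulrA invfM -mulrA mulVf ?gt_eqF // mulr1.
  by rewrite ltr_pdivrMr // ltr_pMr // ltr1n.
move=> s [s0 s1 sE]; have /ngon_radius : ngon n c v (vertex n c v k + t%:C * d).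
  by exists s.
have -> : vertex n c v k + t%:C * d - c = (1 + t)%:C * d.
  by rewrite addrAC -/d rmorphD /= mulrDl mul1r.
rewrite normcM normc_real ger0_norm; last by rewrite addr_ge0 // ltW.
by rewrite dr ger_pMl // leNgt ltrDl t0.
Qed.

(** Since the $d_k$ sum to 0, the cross terms cancel in $\sum_k |a + d_k|^2 = n(|a|^2 + r^2)$, and
    the bound $n r^2$ forces $a = 0$. Thus a regular polygon inside a disk of its own circumradius
    is concentric with it. *)
Lemma circumcenter_unique n (d : 'I_n -> C) a (r : R) : (0 < n)%N ->
  \sum_k d k = 0 -> (forall k, normc (d k) = r) ->
  (forall k, normc (a + d k) <= r) -> a = 0.
Proof.
move=> n0 d0 dr le_r; apply: eq0_normc; apply/eqP.
suff : normc a ^+ 2 *+ n == 0.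
  by rewrite mulrn_eq0 expf_eq0 /= eqn0Ngt n0.
have Re_sum : \sum_k complex.Re (d k) = complex.Re (\sum_k d k).
  by symmetry; apply: (big_morph (@complex.Re R)) => [[? ?] [? ?]|].
have Im_sum : \sum_k complex.Im (d k) = complex.Im (\sum_k d k).
  by symmetry; apply: (big_morph (@complex.Im R)) => [[? ?] [? ?]|].
have cross : \sum_k (complex.Re a * complex.Re (d k) + complex.Im a * complex.Im (d k)) = 0.
  by rewrite big_split /= -!mulr_sumr Re_sum Im_sum d0 /= !mulr0 addr0.
have expand k : normc (a + d k) ^+ 2 = normc a ^+ 2 + r ^+ 2 +
    2 * (complex.Re a * complex.Re (d k) + complex.Im a * complex.Im (d k)).
  rewrite -(dr k) !normc_sqr; clear; case: a (d k) => [a1 a2] [d1 d2] /=; ring.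
have : \sum_k normc (a + d k) ^+ 2 <= \sum_(k < n) r ^+ 2.
  by apply: ler_sum => k _; rewrite ler_sqr ?nnegrE ?normc_ge0 // -(dr k) normc_ge0.
under eq_bigr do rewrite expand.
rewrite big_split /= -mulr_sumr cross mulr0 addr0 big_split /= gerDr.
rewrite sumr_const card_ord => le0.
by rewrite eq_le le0 mulrn_wge0 ?sqr_ge0.
Qed.

End Polygon.

(** * Isometries of the plane and their lifts *)

Section PlaneIsometries.
Context {R : realType}.
Local Notation C := R[i].
Local Notation cj := (@conjc R).
Implicit Types (z w u alpha : C) (h J : C -> C).

Lemma phi_eq alpha z w : alpha != 0 ->
  phi alpha z = phi alpha w <-> exists n : int, z = w + n%:~R * alpha.
Proof.
move=> a0; have pi2 : (2 * pi)%:C != 0 :> C.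
  by rewrite eq_complex /= eqxx andbT gt_eqF // mulr_gt0 ?pi_gt0.
have i0 : 'i != 0 :> C by rewrite eq_complex /= oner_eq0 andbF.
have arg n : 0 +i* (2 * pi * n%:~R) = (2 * pi)%:C * 'i * n%:~R :> C.
  by rewrite -intrC; simpc.
rewrite /phi; split=> [e|[n ->]].
  have : cexp ((2 * pi)%:C * 'i * z / alpha - (2 * pi)%:C * 'i * w / alpha) = 1.
    apply: (mulIf (cexp_neq0 ((2 * pi)%:C * 'i * w / alpha))).
    by rewrite -cexpD subrK e mul1r.
  move=> /cexp_eq1[n]; rewrite arg => en; exists n.
  have {}en : (2 * pi)%:C * 'i * (z / alpha - w / alpha) = (2 * pi)%:C * 'i * n%:~R.
    by rewrite -en; ring.
  move: en => /(mulfI (mulf_neq0 pi2 i0)) en.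
  apply: (mulIf (invr_neq0 a0)); rewrite mulrDl mulfK // -en.
  by rewrite addrC subrK.
have -> : (2 * pi)%:C * 'i * (w + n%:~R * alpha) / alpha =
    (2 * pi)%:C * 'i * w / alpha + (2 * pi)%:C * 'i * n%:~R :> C by field.
by rewrite cexpD -arg cexp_periodic mulr1.
Qed.

Lemma phiD alpha z w : phi alpha (z + w) = phi alpha z * phi alpha w.
Proof. by rewrite /phi -cexpD; congr cexp; ring. Qed.

(** After division by [h 1] the map fixes 0 and 1, and the distances to these points determine real
    parts. The image of $i$ is then $\pm i$, and the distance to it determines imaginary parts up to
    this one global sign. *)
Lemma isometry_orthogonal h : Defs.isometry h -> h 0 = 0 ->
  exists2 u, normc u = 1 & (forall z, h z = u * z) \/ (forall z, h z = u * cj z).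
Proof.
move=> hiso h0.
have hnorm z : normc (h z) = normc z by rewrite -[h z]subr0 -h0 hiso subr0.
have u1 : normc (h 1) = 1 by rewrite hnorm normc1.
exists (h 1) => //; have u0 : h 1 != 0 by rewrite -normc_gt0 u1.
pose g z := h z / h 1.
have g1 : g 1 = 1 by rewrite /g divff.
have giso z w : normc (g z - g w) = normc (z - w).
  by rewrite /g -mulrBl normcM normcV u1 invr1 mulr1 hiso.
have gnorm z : normc (g z) = normc z by rewrite normcM normcV u1 invr1 mulr1.
have gRe z : complex.Re (g z) = complex.Re z.
  have := normc_sqr (g z - g 1); rewrite giso normc_sqr g1.
  have := normc_sqr (g z); rewrite gnorm normc_sqr; case: z (g z) => [c d] [a b] /= e1 e2.
  by rewrite !oppr0 !addr0 in e2; lra.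
pose ii : C := 0 +i* 1.
have gi2 : complex.Im (g ii) ^+ 2 = 1.
  have := normc_sqr (g ii); rewrite gnorm normc_sqr gRe /= => e.
  by move: e; rewrite expr0n expr1n; lra.
have gIm z : complex.Im (g z) * complex.Im (g ii) = complex.Im z.
  have := normc_sqr (g z - g ii); rewrite giso normc_sqr.
  have := normc_sqr (g z); rewrite gnorm normc_sqr.
  have := gRe z; have := gRe ii; move: gi2.
  case: z (g z) (g ii) => [e f] [a b] [c d] /= d2 c0 ae; rewrite ae c0 => e1 e2.
  by nra.
have gE z : h z = h 1 * g z by rewrite /g mulrCA divff // mulr1.
have := gi2; move/eqP; rewrite sqrf_eq1 => /orP[] /eqP gi; [left|right] => z.
  rewrite gE; congr (_ * _); have := gRe z; have := gIm z; rewrite gi mulr1.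
  by case: z (g z) => [c d] [a b] /= -> ->.
rewrite gE; congr (_ * _); have := gRe z; have := gIm z; rewrite gi mulrN1.
by case: z (g z) => [c d] [a b] /= <- ->; rewrite opprK.
Qed.

(* The real-linear maps z |-> alpha * J (z / alpha), for these J, are the
   identity and the reflection in the line through 0 orthogonal to alpha. *)
Definition unit_symmetry J : Prop := J = id \/ J = (fun z => - cj z).

Lemma unit_symmetryD J z w : unit_symmetry J -> J (z + w) = J z + J w.
Proof. by case=> -> //; rewrite conjcD opprD. Qed.

Lemma unit_symmetryB J z w : unit_symmetry J -> J (z - w) = J z - J w.
Proof. by case=> -> //; rewrite conjcB opprB addrC opprK. Qed.

Lemma unit_symmetryK J : unit_symmetry J -> involutive J.
Proof. by case=> -> // z; rewrite conjcN opprK conjcK. Qed.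

Lemma normc_unit_symmetry J z : unit_symmetry J -> normc (J z) = normc z.
Proof. by case=> -> //; rewrite normcN normc_conj. Qed.

(** Multiplication by $u = \varphi_\alpha(t)$ lifts to translation by $t$. Conjugation commutes with
    the exponential, and the conjugate of $2\pi i w$ is $2\pi i(-\bar w)$, whence the sign in the
    second form of [J]. *)
Lemma orthogonal_lift alpha u h : alpha != 0 -> normc u = 1 ->
  (forall z, h z = u * z) \/ (forall z, h z = u * cj z) ->
  exists J t, unit_symmetry J /\
    forall z, h (phi alpha z) = phi alpha (alpha * J (z / alpha) + t).
Proof.
move=> a0 u1 hE; have [s us] := cexp_surj_circle u1.
pose t := (s / (2 * pi))%:C * alpha.
have pi2 : 2 * pi != 0 :> R by rewrite gt_eqF // mulr_gt0 ?pi_gt0.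
have phit : phi alpha t = u.
  rewrite us /phi /t mulrA mulfK //; congr cexp; simpc.
  by rewrite mulrC divfK.
case: hE => hE; [exists id|exists (fun z => - cj z)]; exists t; split.
- by left.
- by move=> z; rewrite hE phiD phit mulrC mulrCA divff // mulr1.
- by right.
move=> z; rewrite hE phiD phit mulrC; congr (_ * _).
rewrite /phi -cexp_conj; congr cexp.
rewrite -[in RHS]mulrA [alpha * _]mulrC mulfK //.
rewrite -mulrA; move: (z / alpha) => [a b]; simpc.
by congr (_ +i* _); ring.
Qed.

End PlaneIsometries.

(** * Tilings *)

Section Tilings.
Context {R : realType}.
Local Notation C := R[i].
Local Notation cj := (@conjc R).
Local Notation omega := (@omega R).
Implicit Types (T : tiling) (z w c v alpha : C) (H : C -> C).

Lemma omegaE : omega = nth_root 3.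
Proof. by []. Qed.

Lemma omega_sqr : omega ^+ 2 = - 1 - omega.
Proof.
have := @sum_nth_root R 3 isT; rewrite -omegaE !big_ord_recl big_ord0 /= => e.
by apply/eqP; rewrite -subr_eq0 -e; apply/eqP; rewrite /bump /=; ring.
Qed.

Lemma omega_conj : cj omega = - 1 - omega.
Proof.
have o0 : omega != 0 by apply: cexp_neq0.
apply: (mulfI o0); rewrite -normc_sqr_conj normc_cexp /= expR0 expr1n.
by rewrite mulrBr -expr2 omega_sqr; ring.
Qed.

(** This is the opposite of the trace of [xi T], whose minimal polynomial is $X^2 + sX + 1$ with $s$
    the given integer. *)
Definition trace T : int := if T is T44 then 0 else 1.

Lemma xi_quadratic T : quadratic_unit (trace T) (xi T : C).
Proof.
have omega_quad : quadratic_unit 1 omega.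
  split; rewrite ?mul1r; [exact: omega_sqr|exact: omega_conj|].
  rewrite /omega /cexp /= expR0 !mul0r addr0 mul1r.
  have pig := @pi_gt0 R; apply: sin_gt0_pi; apply/andP; split; lra.
case: T => //; split=> /=; rewrite ?mul0r ?subr0 ?oppr0 ?add0r ?ltr01 //.
  exact: sqr_i.
by simpc.
Qed.

(** The ideal $(2 + \omega)$ has norm 3 and $\omega \equiv 1$ modulo it, so reduction sends $a +
    b\omega$ to $a + b$ in $\mathbb{Z}/3$. *)
Lemma P0P a b : P0 (a%:~R + b%:~R * omega) <-> (3 %| a + b)%Z.
Proof.
have mulE p q : (2 + omega) * (p%:~R + q%:~R * omega) =
    (2 * p - q)%:~R + (p + q)%:~R * omega.
  transitivity (2 * p%:~R + (2 * q%:~R + p%:~R) * omega + q%:~R * omega ^+ 2).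
    by ring.
  by rewrite omega_sqr; ring.
split=> [[_ [p [q ->]]]|/dvdzP[p pE]].
  rewrite mulE => /(quad_inj (xi_quadratic T63))[<- <-].
  by apply/dvdzP; exists p; ring.
(* With $a + b = 3p$, this solves $2p - q = a$ and $p + q = b$. *)
exists (p%:~R + (b - p)%:~R * omega); first by exists p, (b - p).
rewrite mulE; congr (_%:~R + _%:~R * _); last by rewrite addrC subrK.
by rewrite -(addrK b a) pE; ring.
Qed.

Lemma P0_Zadj z : P0 z -> Zadj omega z.
Proof.
case=> w wZ <-; apply: (ZadjM (xi_quadratic T63)) => //.
by exists 2, 1; rewrite mul1r.
Qed.

Lemma P0D z w : P0 z -> P0 w -> P0 (z + w).
Proof. by move=> [a az <-] [b bz <-]; exists (a + b); [exact: ZadjD|rewrite mulrDr]. Qed.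

Lemma P0M z w : P0 z -> Zadj omega w -> P0 (z * w).
Proof.
move=> [a az <-] wz; exists (a * w); last by rewrite mulrA.
exact: (ZadjM (xi_quadratic T63)).
Qed.

Lemma P0N z : P0 z -> P0 (- z).
Proof. by move=> [a az <-]; exists (- a); [exact: ZadjN|rewrite mulrN]. Qed.

Lemma centers_Zxi T z : centers T z -> Zxi T z.
Proof. by case: T => // -[]. Qed.

Lemma Lambda_Zxi T z : Lambda T z -> Zxi T z.
Proof. by case: T => //; apply: P0_Zadj. Qed.

Lemma LambdaM T z w : Lambda T z -> Zxi T w -> Lambda T (z * w).
Proof.
case: T; [exact: (ZadjM (xi_quadratic T44))|exact: (ZadjM (xi_quadratic T63))|].
exact: P0M.
Qed.

Lemma Lambda_int T z (n : int) : Lambda T z -> Lambda T (n%:~R * z).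
Proof. by move=> Lz; rewrite mulrC; apply: LambdaM => //; apply: Zadj_int. Qed.

Lemma centersD T z d : centers T z -> Lambda T d -> centers T (z + d).
Proof.
case: T => /=; [exact: ZadjD|exact: ZadjD|move=> [zZ zP] dP].
split; first by apply: ZadjD => //; apply: P0_Zadj.
by move=> zdP; apply: zP; rewrite -(addrK d z); apply: P0D => //; apply: P0N.
Qed.

(** The point 1, unlike 0, is a center in all three tilings and serves as a common base point. *)
Lemma centers1 T : centers T (1 : C).
Proof.
case: T; [exact: Zadj1|exact: Zadj1|split; first exact: Zadj1].
have -> : 1 = 1%:~R + 0%:~R * omega by rewrite mul0r addr0.
by move/P0P.
Qed.

Definition corners T : nat := match T with T44 => 4 | T63 => 6 | T36 => 3 end.

(** A tile is recorded by its center and one vertex, so that later arguments treat the three tilings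
    uniformly. *)
Definition tile_at T c v : Prop :=
  match T with
  | T44 => centers T44 c /\ v = c + (1 + 'i) / 2
  | T63 => centers T63 c /\ v = c + (2 + omega)^-1
  | T36 => [/\ centers T36 c, P0 v & normc (v - c) = 1]
  end.

Lemma tilesP T (X : set C) :
  tiles T X <-> exists c v, tile_at T c v /\ X = ngon (corners T) c v.
Proof.
case: T => /=.
- split=> [[c cP <-]|[c [_ [[cP ->] ->]]]]; last by exists c.
  by do 2!eexists; split; last reflexivity.
- split=> [[c cP <-]|[c [_ [[cP ->] ->]]]]; last by exists c.
  by do 2!eexists; split; last reflexivity.
- split=> [[c [v [cP vP vc ->]]]|[c [v [[cP vP vc] ->]]]].
    by exists c, v.
  by exists c, v.
Qed.

Lemma corners_gt1 T : (1 < corners T)%N.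
Proof. by case: T. Qed.

Lemma tile_at_center T c v : tile_at T c v -> centers T c.
Proof. by case: T => -[]. Qed.

Lemma tile_at_translate T c v d : Lambda T d -> tile_at T c v ->
  tile_at T (c + d) (v + d).
Proof.
move=> dL; case: T dL => /= dL.
- by move=> [cZ ->]; split; [exact: ZadjD|rewrite addrAC].
- by move=> [cZ ->]; split; [exact: ZadjD|rewrite addrAC].
move=> [cP vP vc]; split; [exact: (@centersD T36)|exact: P0D|].
by rewrite opprD addrACA subrr addr0.
Qed.

Lemma tile_at_exists T c : centers T c -> exists v, tile_at T c v.
Proof.
case: T => /= cP; [by eexists; split|by eexists; split|].
case: (cP) => -[a [b cE]] ncP.
have nd : ~ (3 %| a + b)%Z by move=> /P0P; rewrite -cE.
(* As 3 does not divide $a + b$, it divides $a + b + 1$ or $a + b - 1$: one of the two horizontal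
   neighbors of [c] is a vertex. *)
have [d d1 vP] : exists2 d : int, `|d| = 1 & (3 %| a + d + b)%Z.
  have r0 := modz_ge0 (a + b) (isT : 3 != 0 :> int).
  have r1 := ltz_pmod (a + b) (isT : 0 < 3 :> int).
  have E := divz_eq (a + b) 3.
  have : ((a + b) %% 3)%Z != 0 by apply/eqP => r; apply: nd; apply/dvdz_mod0P.
  move: E r0 r1; move: (_ %/ 3)%Z (_ %% 3)%Z => q r E r0 r1 rn0.
  have [r_eq|r_eq] : r = 1 \/ r = 2 by lia.
    by exists (-1) => //; apply/dvdzP; exists q; lia.
  by exists 1 => //; apply/dvdzP; exists (q + 1); lia.
exists (c + d%:~R); split; first exact: cP.
  by rewrite cE addrAC -intrD; apply/P0P.
by rewrite addrAC subrr add0r normc_intr -intr_norm d1.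
Qed.

(** Finiteness of the set of offsets provides a positive minimum for functions of $v - c$. *)
Lemma tile_at_offsets T : exists s : seq C,
  forall c v, tile_at T c v -> v - c \in s.
Proof.
case: T => /=.
- exists [:: (1 + 'i) / 2] => c _ [_ ->].
  by rewrite addrAC subrr add0r mem_seq1.
- exists [:: (2 + omega)^-1] => c _ [_ ->].
  by rewrite addrAC subrr add0r mem_seq1.
(* For triangles the offset has norm $a^2 - ab + b^2 = 1$, which forces $|a|, |b| \le 1$. The nine
   candidates include the six units. *)
exists [seq (a%:~R + b%:~R * omega) | a <- [:: -1; 0; 1 : int], b <- [:: -1; 0; 1 : int]].
move=> c v [[cZ _] /P0_Zadj vZ vc].
have [a [b vcE]] := ZadjB vZ cZ.
have := quad_norm (xi_quadratic T63) a b; rewrite -vcE vc expr1n /= mul1r => /esym/eqP.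
rewrite -[1]/(1%:~R) eqr_int => /eqP ab1.
have a3 : a = -1 \/ a = 0 \/ a = 1.
  have : -1 <= a /\ a <= 1 by split; nia.
  by lia.
have b3 : b = -1 \/ b = 0 \/ b = 1.
  have : -1 <= b /\ b <= 1 by split; nia.
  by lia.
by rewrite {}vcE; case: a3 b3 => [->|[->|->]] [->|[->|->]]; rewrite !inE eqxx ?orbT.
Qed.

Lemma tile_at_radius T : exists2 r : R, 0 < r &
  forall c v, tile_at T c v -> normc (v - c) = r.
Proof.
have two : 2 != 0 :> C by rewrite pnatr_eq0.
case: T => /=.
- exists (normc ((1 + 'i) / 2)) => [|c _ [_ ->]]; last by rewrite addrAC subrr add0r.
  rewrite normc_gt0 mulf_neq0 ?invr_neq0 // -complexiE eq_complex /= addr0.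
  by rewrite oner_eq0.
- exists (normc (2 + omega)^-1) => [|c _ [_ ->]]; last by rewrite addrAC subrr add0r.
  rewrite normc_gt0 invr_neq0 //; apply/eqP => e.
  have := @quad_inj _ _ _ (xi_quadratic T63) 2 1 0 0.
  by rewrite mul1r mul0r addr0 => /(_ e)[].
- by exists 1 => // c v [].
Qed.

(** Vertices are boundary points, so the maximum in the definition of admissibility bounds their
    distances, and by convexity all distances within a tile. *)
Lemma admissible_diam T alpha : admissible T alpha ->
  exists2 m, m < normc alpha &
    forall c v, tile_at T c v -> forall z w, ngon (corners T) c v z ->
      ngon (corners T) c v w -> normc (z - w) <= m.
Proof.
move=> [_ _ [m [_ le_m] m_lt]]; exists m => // c v cv z w zn wn.
have [r r0 rE] := tile_at_radius T.
have vc : v != c by rewrite -subr_eq0 -normc_gt0 (rE _ _ cv).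
apply: ngon_diam zn wn => j k; apply: le_m.
exists (ngon (corners T) c v), (vertex (corners T) c v j), (vertex (corners T) c v k).
split=> //; [by apply/tilesP; exists c, v| |]; exact: vertex_boundary.
Qed.

(* The translates of the second polygon by integer multiples of alpha are at
   mutual distance at least |alpha| - m, so a segment cannot leave one. *)
Lemma ngon_in_translate n c v c' v' alpha (m : R) H : (1 < n)%N ->
  (forall z w, normc (H z - H w) = normc (z - w)) -> m < normc alpha ->
  (forall z w, ngon n c' v' z -> ngon n c' v' w -> normc (z - w) <= m) ->
  (forall z, ngon n c v z -> exists k : int, ngon n c' v' (H z - k%:~R * alpha)) ->
  exists k : int, forall z, ngon n c v z -> ngon n c' v' (H z - k%:~R * alpha).
Proof.
move=> n1 Hiso m_lt diam Hin; have cn := @ngon_center _ _ c v n1.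
have [k0 k0P] := Hin _ cn; exists k0 => z zn.
(* The segment from [c] to [z] is cut into [N] steps, each shorter than $|\alpha| - m$. *)
pose N := (Num.truncn (normc (z - c) / (normc alpha - m))).+1.
have N0 : 0 < N%:R :> R by rewrite ltr0n.
have stepN : normc (z - c) / N%:R < normc alpha - m.
  rewrite ltr_pdivrMr // mulrC -ltr_pdivrMr ?subr_gt0 //.
  exact: truncnS_gt.
pose p j := c + (j%:R / N%:R : R)%:C * (z - c).
have pn j : (j <= N)%N -> ngon n c v (p j).
  move=> jN; apply: ngon_segment => //.
  by rewrite divr_ge0 //= ler_pdivrMr // mul1r ler_nat.
suff walk j : (j <= N)%N -> ngon n c' v' (H (p j) - k0%:~R * alpha).
  have pN : p N = z by rewrite /p divff ?gt_eqF // mul1r addrC subrK.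
  by rewrite -pN; apply: walk.
elim: j => [_|j IH jN]; first by rewrite /p mul0r mul0r addr0.
have [k kP] := Hin _ (pn _ jN); have {}IH := IH (ltnW jN).
suff -> : k0 = k by [].
have alpha0 : 0 < normc alpha.
  by apply: le_lt_trans m_lt; have := diam _ _ kP kP; rewrite subrr normc0.
(* If consecutive points lie in the translates $k_0$ and $k$, then $|(k - k_0)\alpha|$ is at most
   one step plus the diameter bound $m$, hence below $|\alpha|$, and so $k = k_0$. *)
have : normc ((k - k0)%:~R * alpha) < normc alpha.
  have -> : (k - k0)%:~R * alpha = (H (p j.+1) - H (p j)) +
      ((H (p j) - k0%:~R * alpha) - (H (p j.+1) - k%:~R * alpha)) by ring.
  apply: le_lt_trans (le_normcD _ _) _; rewrite -[ltRHS](subrK m).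
  apply: ltr_leD; last exact: diam.
  rewrite Hiso; have -> : p j.+1 - p j = (N%:R^-1 : R)%:C * (z - c).
    rewrite /p opprD addrACA subrr add0r -mulrBl -natr1.
    by congr (_ * _); rewrite mulrDl mul1r; simpc; rewrite addrAC subrr add0r.
  by rewrite normcM normc_real ger0_norm ?invr_ge0 // mulrC.
rewrite normcM normc_intr gtr_pMl // -intr_norm ltrz1 => k1.
by apply/eqP; rewrite eq_sym -subr_eq0; move: k1; lia.
Qed.

End Tilings.

(** * Symmetries of the image tiling *)

Section Symmetries.
Context {R : realType}.
Local Notation C := R[i].
Implicit Types (T : tiling) (z w c v alpha t : C) (h J : C -> C).

Lemma normc_phi alpha z :
  normc (phi alpha z) = expR (- (2 * pi * complex.Im (z / alpha))).
Proof.
rewrite /phi normc_cexp; congr expR; rewrite -mulrA -complexiE.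
by case: (z / alpha) => a b; simpc.
Qed.

Lemma normc_ge_Im z : `|complex.Im z| <= normc z.
Proof.
rewrite -ler_sqr ?nnegrE ?normc_ge0 // normc_sqr real_normK ?num_real //.
by rewrite lerDr sqr_ge0.
Qed.

Lemma ngon_corner n c v : (0 < n)%N -> ngon n c v v.
Proof.
move=> n0; have := ngon_vertex c v (Ordinal n0).
by rewrite /vertex expr0 mul1r addrC subrK.
Qed.

(** The modulus of $\varphi_\alpha(z)$ decreases with $\mathrm{Im}(z/\alpha)$, and translation by
    $N\alpha\xi \in \Lambda$ raises this imaginary part by $N\,\mathrm{Im}\,\xi$. *)
Lemma phi_near0 T alpha (e : R) : Lambda T alpha -> alpha != 0 -> 0 < e ->
  exists c v, tile_at T c v /\
    forall z, ngon (corners T) c v z -> normc (phi alpha z) <= e.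
Proof.
move=> La a0 e0; have [r r0 rE] := @tile_at_radius R T.
have [v0 cv0] := tile_at_exists (@centers1 R T).
have [_ _ xi0] := @xi_quadratic R T.
have an0 : 0 < normc alpha by rewrite normc_gt0.
pose B := (1 + r) / normc alpha.
have Bn z : ngon (corners T) 1 v0 z -> - B <= complex.Im (z / alpha).
  move=> zn; rewrite lerNl; apply: le_trans (_ : `|complex.Im (z / alpha)| <= _).
    by rewrite -normrN ler_norm.
  apply: le_trans (normc_ge_Im _) _; rewrite normcM normcV ler_pM2r ?invr_gt0 //.
  rewrite -[z](subrK 1) addrC; apply: le_trans (le_normcD _ _) _.
  by rewrite normc1 lerD2l -(rE _ _ cv0) (ngon_radius zn).
(* Since $\mathrm{Im}(z/\alpha) \ge -B$ on the base tile, any $N > x$ pushes it above $-\ln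
   e/(2\pi)$ on the translate. *)
pose x := (B - ln e / (2 * pi)) / complex.Im (xi T : C).
pose N := (Num.truncn x).+1.
pose d := (N%:Z)%:~R * (alpha * xi T).
have dL : Lambda T d.
  by apply: Lambda_int; apply: LambdaM => //; apply: Zadj_gen.
exists (1 + d), (v0 + d); split; first exact: tile_at_translate.
move=> z /(ngon_translate (- d)); rewrite !addrK => /Bn.
have -> : complex.Im ((z - d) / alpha) =
    complex.Im (z / alpha) - N%:R * complex.Im (xi T : C).
  rewrite /d mulrBl [alpha * _]mulrC mulrA mulfK // -pmulrn.
  by rewrite -[N%:R in LHS]natrC; case: (z / alpha) (xi T) => [a b] [a' b'] /=; simpc.
move=> zB; rewrite normc_phi -[e]lnK ?posrE // ler_expR.
have pi2 : 0 < 2 * pi :> R by rewrite mulr_gt0 ?pi_gt0.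
rewrite -mulrN mulrC -ler_pdivlMr // lerNl.
have := truncnS_gt x; rewrite -/N {1}/x ltr_pdivrMr //.
by move: zB; lra.
Qed.

Lemma seq_lower_bound (f : C -> R) (s : seq C) :
  exists2 k, 0 < k & forall d, d \in s -> 0 < f d -> k <= f d.
Proof.
elim: s => [|d s [k k0 kP]]; first by exists 1.
have [fd|fd] := leP (f d) 0.
  exists k => // d'; rewrite inE => /orP[/eqP ->|/kP//].
  by move=> /lt_le_trans/(_ fd); rewrite ltxx.
exists (Num.min k (f d)); first by rewrite lt_min k0 fd.
move=> d'; rewrite inE ge_min => /orP[/eqP ->|ds fd']; first by rewrite lexx orbT.
by rewrite kP.
Qed.

Lemma symmetry_tiles_image T alpha h c v :
  symmetry_tiles (S_ T alpha) h -> tile_at T c v ->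
  exists c' v', tile_at T c' v' /\
    h @` (phi alpha @` ngon (corners T) c v) = phi alpha @` ngon (corners T) c' v'.
Proof.
move=> [_ hS] cv.
have : S_ T alpha (h @` (phi alpha @` ngon (corners T) c v)).
  rewrite -[X in X _]hS; exists (phi alpha @` ngon (corners T) c v) => //.
  by exists (ngon (corners T) c v) => //; apply/tilesP; exists c, v.
by case=> X /tilesP[c' [v' [cv' ->]]] <-; exists c', v'.
Qed.

Lemma symmetry_tiles_preimage T alpha h c' v' :
  symmetry_tiles (S_ T alpha) h -> tile_at T c' v' ->
  exists c v, tile_at T c v /\
    h @` (phi alpha @` ngon (corners T) c v) = phi alpha @` ngon (corners T) c' v'.
Proof.
move=> [_ hS] cv'.
have : S_ T alpha (phi alpha @` ngon (corners T) c' v').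
  by exists (ngon (corners T) c' v') => //; apply/tilesP; exists c', v'.
rewrite -[X in X _]hS => -[Y [X /tilesP[c [v [cv ->]]] <-] <-].
by exists c, v.
Qed.

(* Tiles close to 0 are arbitrarily small, whereas the tiles close to any other
   point have diameters bounded from below. *)
Lemma symmetry_tiles_fix0 T alpha h : admissible T alpha ->
  symmetry_tiles (S_ T alpha) h -> h 0 = 0.
Proof.
move=> adm hS; have [a0 La _] := adm; have [hiso _] := hS.
have [m m_lt diam] := admissible_diam adm.
have [r r0 rE] := @tile_at_radius R T.
have n0 : (0 < corners T)%N by apply/ltnW/corners_gt1.
have [s sP] := @tile_at_offsets R T.
have [k k0 kP] := seq_lower_bound (fun d => normc (phi alpha d - 1)) s.
have {sP}kP c v : tile_at T c v -> k <= normc (phi alpha (v - c) - 1).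
  move=> cv; apply: kP (sP _ _ cv) _; rewrite normc_gt0 subr_eq0.
  (* Equality would make the offset an integer multiple of $\alpha$; being shorter than $|\alpha|$,
     it would be 0, against the positive circumradius. *)
  apply/eqP => e; have : phi alpha (v - c) = phi alpha 0.
    by rewrite e /phi mulr0 mul0r cexp0.
  move=> /(phi_eq _ _ a0)[n]; rewrite add0r => vcE.
  have : normc (v - c) < normc alpha.
    apply: le_lt_trans m_lt; apply: (diam c v) => //; first exact: ngon_corner.
    by apply: ngon_center; apply: corners_gt1.
  rewrite {1}vcE normcM normc_intr gtr_pMl ?normc_gt0 // -intr_norm ltrz1 => n1.
  have n_eq0 : n = 0 by move: n1; lia.
  by move: (rE _ _ cv) r0; rewrite vcE n_eq0 mul0r normc0 => <-; rewrite ltxx.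
apply/eqP; apply: contraT; rewrite -normc_gt0 => h0.
(* The image of a tile within $e$ of 0 lies within $e$ of $h(0)$, which gives $(|h(0)| - e)k \le
   2e$. This choice makes $e(2 + k)$ half of $|h(0)|k$, a contradiction. *)
pose e := normc (h 0) * k / (2 * (2 + k)).
have e0 : 0 < e by rewrite divr_gt0 ?mulr_gt0 // addr_gt0.
have eE : e * (2 * (2 + k)) = normc (h 0) * k.
  by rewrite /e divfK // gt_eqF // mulr_gt0 // addr_gt0.
have [c [v [cv small]]] := phi_near0 La a0 e0.
have [c' [v' [cv' hX]]] := symmetry_tiles_image hS cv.
have close w : ngon (corners T) c' v' w ->
    exists2 x, h x = phi alpha w & normc x <= e.
  move=> wn; have : (phi alpha @` ngon (corners T) c' v') (phi alpha w) by exists w.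
  by rewrite -hX => -[x [z zn zx] xw]; exists x => //; rewrite -zx small.
have [x hx xe] := close _ (ngon_center c' v' (corners_gt1 T)).
have [y hy ye] := close _ (ngon_corner c' v' n0).
have far : normc (h 0) - e <= normc (phi alpha c').
  rewrite lerBlDr -[h 0](subrK (h x)) addrC hx.
  apply: le_trans (le_normcD _ _) _; rewrite lerD2l -hx hiso sub0r normcN.
  exact: xe.
have near : normc (phi alpha v' - phi alpha c') <= e + e.
  rewrite -hx -hy hiso; apply: le_trans (le_normcD _ _) _.
  by rewrite normcN lerD.
have split_phi : phi alpha v' - phi alpha c' = phi alpha c' * (phi alpha (v' - c') - 1).
  by rewrite mulrBr mulr1 -phiD [c' + _]addrC subrK.
rewrite split_phi normcM in near.
have := ler_pM _ (ltW k0) far (kP _ _ cv').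
have eh : e <= normc (h 0) by move: eE; nra.
by rewrite subr_ge0 => /(_ eh) le1; have := le_trans le1 near; move: eE; nra.
Qed.

(** * The lift of a symmetry to the plane and its action on the centers *)

Section Lift.
Variables (T : tiling) (alpha : C) (h J : C -> C) (t : C).
Hypotheses (adm : admissible T alpha) (hS : symmetry_tiles (S_ T alpha) h).
Hypothesis Jsym : unit_symmetry J.
Let H z := alpha * J (z / alpha) + t.
Hypothesis hH : forall z, h (phi alpha z) = phi alpha (H z).

Lemma lift_isometry z w : normc (H z - H w) = normc (z - w).
Proof.
have [a0 _ _] := adm.
rewrite /H opprD addrACA subrr addr0 -mulrBr -unit_symmetryB // -mulrBl.
by rewrite normcM normc_unit_symmetry // -normcM mulrC divfK.
Qed.

(** By [ngon_in_translate], [H] sends the whole tile into a single translate of the other. All tiles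
    have the same circumradius and [J] is additive, so [circumcenter_unique] applies to the images
    of the vertices. *)
Lemma lift_center c v c' v' : tile_at T c v -> tile_at T c' v' ->
  h @` (phi alpha @` ngon (corners T) c v) = phi alpha @` ngon (corners T) c' v' ->
  exists k : int, H c = c' + k%:~R * alpha.
Proof.
move=> cv cv' hX; have [a0 _ _] := adm.
have [m m_lt diam] := admissible_diam adm.
have [r r0 rE] := @tile_at_radius R T.
have n1 := corners_gt1 T; have n0 : (0 < corners T)%N by apply: ltnW.
have in_translate z : ngon (corners T) c v z ->
    exists k : int, ngon (corners T) c' v' (H z - k%:~R * alpha).
  move=> zn; have : (phi alpha @` ngon (corners T) c' v') (phi alpha (H z)).
    by rewrite -hX -hH; exists (phi alpha z) => //; exists z.
  by case=> w wn /esym/(phi_eq _ _ a0)[k ->]; exists k; rewrite addrK.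
have [k kP] := ngon_in_translate n1 lift_isometry m_lt (diam _ _ cv') in_translate.
exists k; apply/eqP; rewrite -subr_eq0; apply/eqP.
apply: (@circumcenter_unique _ _ (fun j : 'I_(corners T) =>
  H (vertex (corners T) c v j) - H c) _ r n0).
- transitivity (\sum_(j < corners T)
      alpha * J ((vertex (corners T) c v j - c) / alpha)).
    apply: eq_bigr => j _; rewrite /H opprD addrACA subrr addr0 -mulrBr.
    by rewrite -unit_symmetryB // -mulrBl.
  have J0 : J 0 = 0 by have := unit_symmetryB 0 0 Jsym; rewrite !subrr.
  rewrite -mulr_sumr -(big_morph J (fun x y => unit_symmetryD x y Jsym) J0).
  by rewrite -mulr_suml sum_vertex // mul0r J0 mulr0.
- by move=> j; rewrite lift_isometry normc_vertex (rE _ _ cv).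
move=> j; have := ngon_radius (kP _ (ngon_vertex c v j)); rewrite (rE _ _ cv').
by congr (normc _ <= _); ring.
Qed.

Lemma lift_centers : H @` centers T = centers T.
Proof.
have [a0 La _] := adm.
apply/seteqP; split=> [_ [c cP <-]|c' cP'].
  have [v cv] := tile_at_exists cP.
  have [c' [v' [cv' hX]]] := symmetry_tiles_image hS cv.
  have [k ->] := lift_center cv cv' hX.
  by apply: centersD; [exact: tile_at_center cv'|exact: Lambda_int].
have [v' cv'] := tile_at_exists cP'.
have [c [v [cv hX]]] := symmetry_tiles_preimage hS cv'.
have [k Hc] := lift_center cv cv' hX.
(* The reflection sends $\alpha$-translations to their inverses, so $c' = H(c) - k\alpha$ is the
   image of $c - k'\alpha$ with $k' = J(k) = \pm k$. *)
have Jk : exists k', J k%:~R = (k'%:~R : C).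
  by case: Jsym => ->; [exists k|exists (- k); rewrite conjc_int rmorphN].
have [k' k'E] := Jk; exists (c - k'%:~R * alpha).
  by rewrite -mulNr -rmorphN; apply: centersD;
    [exact: tile_at_center cv|exact: Lambda_int].
rewrite /H mulrBl mulfK // unit_symmetryB // -k'E unit_symmetryK // mulrBr.
by rewrite addrAC -/(H c) Hc [alpha * _]mulrC addrK.
Qed.

End Lift.
End Symmetries.

(** * Colorings *)

Section Colorings.
Context {R : realType}.
Local Notation C := R[i].
Implicit Types (T : tiling) (z w u beta alpha : C).

(** Maps with the same fibers on [A] factor through each other on their images; [i0] is only a
    default for choosing preimages. *)
Lemma card_image_eq {I : choiceType} {U V : Type} (i0 : I) (A : set I) (F : I -> U) (G : I -> V) :
  (forall x y, A x -> A y -> F x = F y <-> G x = G y) -> (F @` A #= G @` A)%card.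
Proof.
move=> FG.
have half U' V' (F' : I -> U') (G' : I -> V') :
    (forall x y, A x -> A y -> G' x = G' y -> F' x = F' y) -> (F' @` A #<= G' @` A)%card.
  move=> GF; pose s y := F' (xget i0 [set x | A x /\ G' x = y]).
  suff -> : F' @` A = s @` (G' @` A) by apply: card_image_le.
  have sE x : A x -> s (G' x) = F' x.
    rewrite /s => Ax; case: xgetP => [y _ [Ay yx]|/(_ x)]; first exact: GF.
    by case.
  rewrite image_comp; apply/seteqP.
  by split=> _ [x Ax <-]; exists x => //=; rewrite sE.
by rewrite card_eq_le; apply/andP; split; apply: half => x y Ax Ay;
  move/(FG _ _ Ax Ay).
Qed.

Definition color_class T beta z : set C :=
  [set z + w | w in ideal T beta] `&` centers T.

Lemma color_classP T beta z w : color_class T beta z w <->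
  centers T w /\ exists2 u, Zxi T u & w - z = beta * u.
Proof.
split=> [[[_ [u uZ <-] <-] wP]|[wP [u uZ wz]]].
  by split=> //; exists u => //; rewrite addrC addrA addNr add0r.
by split=> //; exists (beta * u); [exists u|rewrite -wz addrC subrK].
Qed.

Lemma color_class_refl T beta z : centers T z -> color_class T beta z z.
Proof.
by move=> zP; apply/color_classP; split=> //; exists 0; rewrite ?subrr ?mulr0 //; apply: Zadj0.
Qed.

Lemma color_class_eq T beta z w : centers T z ->
  color_class T beta z = color_class T beta w <->
  exists2 u, Zxi T u & z - w = beta * u.
Proof.
move=> zP; split=> [e|[u uZ zw]].
  have := color_class_refl beta zP; rewrite e => /color_classP[_ [u uZ zw]].
  by exists u.
apply/seteqP; split=> x /color_classP[xP [u' u'Z xz]]; apply/color_classP; split=> //.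
  exists (u' + u); first exact: ZadjD.
  by rewrite mulrDr -xz -zw addrA subrK.
exists (u' - u); first exact: ZadjB.
by rewrite mulrBr -xz -zw opprB addrA subrK.
Qed.

(** A coset that meets the centers is the coset of any center in it, so indexing by centers accounts
    for nonemptiness. *)
Lemma induced_coloringE T beta :
  induced_coloring T beta = color_class T beta @` centers T.
Proof.
apply/seteqP; split=> [Y [[w Yw] [_ [z zZ <-] YE]]|_ [z zP <-]].
  have wC : color_class T beta z w by rewrite -[color_class _ _ _]YE.
  have [wP wz] := (color_classP _ _ _ _).1 wC.
  by exists w => //; rewrite YE -/(color_class T beta z); apply/color_class_eq.
split; first by exists z; apply: color_class_refl.
by exists [set z + w | w in ideal T beta] => //; exists z => //; apply: centers_Zxi.
Qed.

Lemma compatibleP T beta alpha : alpha != 0 -> Lambda T alpha ->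
  compatible alpha (induced_coloring T beta) <->
  exists2 u, Zxi T u & alpha = beta * u.
Proof.
move=> a0 La; rewrite induced_coloringE; split=> [comp|[u uZ aE]].
  (* The centers $1$ and $1 + \alpha$ have the same image, so compatibility puts them in one
     class. *)
  have cP := @centersD _ _ _ _ (centers1 T) La.
  have : color_class T beta (1 + alpha) = color_class T beta 1.
    apply: comp; [by exists (1 + alpha)|by exists 1; first exact: centers1|].
    exists (phi alpha 1); split; last first.
      by exists 1 => //; apply: color_class_refl; apply: centers1.
    exists (1 + alpha); first exact: color_class_refl.
    by apply/phi_eq => //; exists 1; rewrite mul1r.
  by move=> /color_class_eq => /(_ cP)[u uZ]; rewrite addrAC subrr add0r; exists u.
move=> _ _ [z zP <-] [w wP <-] [_ [[x zx <-] [y wy]]].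
move=> /esym/(phi_eq _ _ a0)[n xy].
have [xP xz] := (color_classP _ _ _ _).1 zx.
have [yP yw] := (color_classP _ _ _ _).1 wy.
have <- := (color_class_eq _ _ xP).2 xz; have <- := (color_class_eq _ _ yP).2 yw.
apply/color_class_eq => //; exists (n%:~R * u).
  by apply: (ZadjM (xi_quadratic T)) => //; apply: Zadj_int.
by rewrite xy addrAC subrr add0r aE mulrCA.
Qed.

Lemma image_coloring_coloring T beta alpha :
  finite_set (induced_coloring T beta) -> compatible alpha (induced_coloring T beta) ->
  coloring (Q_ T alpha) (image_coloring alpha (induced_coloring T beta)).
Proof.
move=> fin comp; split; first exact: finite_image.
rewrite induced_coloringE in comp *; split.
- apply/seteqP; split=> [x [_ [_ [z zP <-] <-] [w /color_classP[wP _] <-]]|_ [z zP <-]].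
    by exists w.
  exists (phi alpha @` color_class T beta z).
    by exists (color_class T beta z) => //; exists z.
  by exists z => //; apply: color_class_refl.
- by move=> _ _ [Y YK <-] [Y' YK' <-] YY'; congr (_ @` _); apply: comp.
- move=> _ [_ [z zP <-] <-]; exists (phi alpha z), z => //.
  exact: color_class_refl.
Qed.

Lemma card_fset_set_eq (U V : choiceType) (A : set U) (B : set V) :
  (A #= B)%card -> finite_set A -> #|` fset_set A| = #|` fset_set B|.
Proof.
move=> AB /finite_setP[n An]; rewrite (card_fset_set An).
by rewrite (card_fset_set (card_eq_trans _ An)) // card_eq_sym.
Qed.

(* If beta = (2 + omega) g, then the cosets of (beta) inside P0 correspond to
   the cosets of (g), which are a third of all the cosets of (beta). *)
Lemma induced_coloring_card T beta : Zxi T beta -> beta != 0 ->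
  [/\ finite_set (induced_coloring T beta),
      (num_colors (induced_coloring T beta))%:R <= normc beta ^+ 2,
      T <> T36 -> (num_colors (induced_coloring T beta))%:R = normc beta ^+ 2 &
      T = T36 -> P0 beta ->
        (num_colors (induced_coloring T beta))%:R = 2 / 3 * normc beta ^+ 2].
Proof.
move=> bZ b0; have [f [N [normN fN fP]]] := norm_index (xi_quadratic T) bZ b0.
have card_f : (induced_coloring T beta #= f @` centers T)%card.
  rewrite induced_coloringE; apply: (card_image_eq (0 : C)) => z w zP wP.
  by rewrite fP; [exact: color_class_eq|exact: centers_Zxi|exact: centers_Zxi].
have sub_f : f @` centers T `<=` `I_N.
  by rewrite -fN; apply: image_subset => z; apply: centers_Zxi.
have fin_f : finite_set (f @` centers T) by apply: (sub_finite_set sub_f).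
have num_f : num_colors (induced_coloring T beta) = #|` fset_set (f @` centers T)|.
  by apply: (card_fset_set_eq card_f); rewrite (eq_finite_set card_f).
have cardN : #|` fset_set `I_N| = N by apply: card_fset_set.
split.
- by rewrite (eq_finite_set card_f).
- rewrite normN ler_nat num_f -[leqRHS]cardN; apply: fsubset_leq_card.
  by rewrite -fset_set_sub.
- move=> T36n; rewrite normN num_f; have -> : centers T = Zxi T by case: (T) T36n.
  by rewrite fN cardN.
move=> T36E; subst T => bP.
have [g gZ bE] := bP; have g0 : g != 0 by apply: contraNneq b0 => g0; rewrite -bE g0 mulr0.
have [f' [N' [normN' fN' fP']]] := norm_index (xi_quadratic T36) gZ g0.
have two0 : 2 + omega != 0 :> C.
  by apply: contraNneq b0 => e; rewrite -bE e mul0r.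
have card_P0 : (f @` P0 #= `I_N')%card.
  rewrite -fN' /P0 image_comp; apply: (card_image_eq (0 : C)) => z w zZ wZ /=.
  have PZ x : Zadj omega x -> Zxi T36 ((2 + omega) * x).
    by move=> xZ; apply: P0_Zadj; exists x.
  rewrite fP ?fP' //; [|exact: PZ|exact: PZ].
  split=> -[u uZ e]; exists u => //; last by rewrite -mulrBr e -bE mulrA.
  by apply: (mulfI two0); rewrite mulrBr e -bE mulrA.
have normE : normc beta ^+ 2 = 3 * normc g ^+ 2.
  rewrite -bE normcM exprMn; congr (_ * _).
  have -> : 2 + omega = 2%:~R + 1%:~R * omega :> C by rewrite mul1r.
  by rewrite (quad_norm (xi_quadratic T63)).
have cupP : `I_N = f @` centers T36 `|` f @` P0.
  rewrite -fN -image_setU; congr (_ @` _); apply/seteqP; split=> z.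
    by have [zP|zP] := pselect (P0 z); [right|left].
  by case=> [[]//|]; apply: P0_Zadj.
(* As [P0] contains $\beta$, it is a union of cosets of $(\beta)$, so no coset meets both [P0] and
   its complement. The count is then $N - N'$ with $N = 3N'$. *)
have capP : f @` centers T36 `&` f @` P0 = set0.
  rewrite -subset0 => _ [[z [zZ znP] <-] [w wP]].
  move=> /esym/(fP _ _ zZ (P0_Zadj wP))[u uZ zw]; apply: znP.
  by rewrite -[z](subrK w) zw; apply: P0D => //; apply: P0M.
have finP0 : finite_set (f @` P0).
  by apply: (@sub_finite_set _ _ `I_N) => //; rewrite cupP; apply: subsetUr.
have : (#|` fset_set (f @` centers T36)| + N')%N = N.
  rewrite -(card_fset_set card_P0) -cardfsUI -fset_setU // -fset_setI //.
  by rewrite capP fset_set0 cardfs0 addn0 -cupP cardN.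
move=> /(congr1 (fun n => n%:R : R)); rewrite num_f natrD -normN -normN' normE.
by lra.
Qed.

(** Compatibility makes taking images injective on classes, because two nonempty classes with equal
    images cannot have disjoint ones. *)
Lemma image_coloring_card T beta alpha :
  finite_set (induced_coloring T beta) -> compatible alpha (induced_coloring T beta) ->
  num_colors (image_coloring alpha (induced_coloring T beta)) =
  num_colors (induced_coloring T beta).
Proof.
move=> fin comp; apply: card_fset_set_eq; last exact: finite_image.
rewrite -[X in (_ #= X)%card](image_id (induced_coloring T beta)).
apply: (card_image_eq (set0 : set C)) => Y Y' YK YK'; split=> [e|-> //].
apply: comp => //; rewrite /= e setIid.
by case: YK' => -[y Yy] _; exists (phi alpha y), y.
Qed.

Lemma symmetry_permutes_colors T alpha h : admissible T alpha ->
  symmetry_tiles (S_ T alpha) h ->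
  permutes_colors (Q_ T alpha) (image_coloring alpha (induced_coloring T alpha)) h.
Proof.
move=> adm hS; have [a0 La _] := adm; have [hiso _] := hS.
have [u u1 hE] := isometry_orthogonal hiso (symmetry_tiles_fix0 adm hS).
have [J [t [Jsym hH]]] := orthogonal_lift a0 u1 hE.
pose H z := alpha * J (z / alpha) + t.
have HP := lift_centers adm hS Jsym hH.
have h_phi X : h @` (phi alpha @` X) = phi alpha @` (H @` X).
  by rewrite !image_comp; apply: eq_imagel => z _; rewrite /= hH.
have HB z w : H z - H w = alpha * J ((z - w) / alpha).
  by rewrite /H opprD addrACA subrr addr0 -mulrBr -unit_symmetryB // -mulrBl.
(* The ring is stable under conjugation, so [J] preserves divisibility of differences by
   $\alpha$. *)
have JZ x : Zxi T x -> Zxi T (J x).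
  case: Jsym => -> // xZ; apply: ZadjN; exact: (Zadj_conj (xi_quadratic T)).
split; first by split=> //; rewrite h_phi HP.
rewrite induced_coloringE => _ [_ [z zP <-] <-]; rewrite h_phi.
exists (color_class T alpha (H z)).
  by exists (H z) => //; rewrite -HP; exists z.
congr (_ @` _); apply/seteqP; split=> [w' /color_classP[w'P [x xZ e]]|].
  have : (H @` centers T) w' by rewrite HP.
  case=> w wP wE; exists w => //; apply/color_classP; split=> //.
  exists (J x); first exact: JZ.
  move: e; rewrite -wE HB => /(mulfI a0) e.
  by rewrite -e unit_symmetryK // mulrC divfK.
move=> _ [w /color_classP[wP [x xZ e]] <-]; apply/color_classP; split.
  by rewrite -HP; exists w.
by exists (J x); [exact: JZ|rewrite HB e mulrAC divff // mul1r].
Qed.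

(** Write $\alpha = \beta u$ with $|u|^2 \ge 1$. For triangles with $\beta \notin P_0$, $u$ cannot
    be a unit, so $|u|^2 \ge 2$ and $|\beta|^2 \le \frac12|\alpha|^2$, which is below
    $\frac23|\alpha|^2$. *)
Lemma ideal_coloring_bound T alpha beta : Zxi T beta -> beta != 0 ->
  alpha != 0 -> Lambda T alpha -> compatible alpha (induced_coloring T beta) ->
  (num_colors (induced_coloring T beta))%:R <=
    (if T is T36 then 2 / 3 else 1) * normc alpha ^+ 2.
Proof.
move=> bZ b0 a0 La /(compatibleP _ a0 La)[u uZ aE].
have [_ le_b eq_b eq_b36] := induced_coloring_card bZ b0.
have u0 : u != 0 by apply: contraNneq a0 => u0; rewrite aE u0 mulr0.
have u1 := Zadj_norm_ge1 (xi_quadratic T) uZ u0.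
have aN : normc alpha ^+ 2 = normc beta ^+ 2 * normc u ^+ 2.
  by rewrite aE normcM exprMn.
have bN := sqr_ge0 (normc beta).
case: T bZ La uZ le_b eq_b eq_b36 u1 => bZ La uZ le_b eq_b eq_b36 u1.
- by rewrite mul1r aN; apply: le_trans le_b _; nra.
- by rewrite mul1r aN; apply: le_trans le_b _; nra.
have [bP|bP] := pselect (P0 beta).
  by rewrite eq_b36 // ler_wpM2l // aN; nra.
apply: le_trans le_b _; rewrite aN.
have [n nE] := Zadj_norm (xi_quadratic T36) uZ.
have [n_le1|n_gt1] := leqP n 1; last first.
  have : 2 <= n%:R :> R by rewrite ler_nat.
  by rewrite -nE; nra.
exfalso; apply: bP; have uN : normc u ^+ 2 = 1.
  by apply/eqP; rewrite eq_le u1 nE lern1 n_le1.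
(* A unit $u$ has inverse $\bar u$, so $\beta$ would be a multiple of $\alpha \in P_0$. *)
have -> : beta = alpha * conjc u.
  by rewrite aE -mulrA -normc_sqr_conj uN mulr1.
by apply: P0M => //; apply: (Zadj_conj (xi_quadratic T36)).
Qed.

End Colorings.

Unset Implicit Arguments.

Theorem corollary16 (R : realType) (T : tiling) (alpha : R[i])
    (adm : admissible T alpha) :
  exists M : R,
    [/\ forall K : set (set R[i]), ideal_coloring T K -> compatible alpha K ->
          coloring (Q_ T alpha) (image_coloring alpha K) /\
          (num_colors (image_coloring alpha K))%:R <= M,
        T = T44 \/ T = T63 -> M = normc alpha ^+ 2,
        T = T36 -> (~ P0 alpha -> M = normc alpha ^+ 2) /\
                   (P0 alpha -> M = 2 / 3 * normc alpha ^+ 2) &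
        exists K : set (set R[i]),
          [/\ ideal_coloring T K, compatible alpha K,
              (num_colors (image_coloring alpha K))%:R = M &
              forall h : R[i] -> R[i], symmetry_tiles (S_ T alpha) h ->
                permutes_colors (Q_ T alpha) (image_coloring alpha K) h]].
Proof.
have [a0 La _] := adm; have aZ := Lambda_Zxi La.
exists ((if T is T36 then 2 / 3 else 1) * normc alpha ^+ 2); split.
- move=> _ [beta [bZ b0 ->]] comp.
  have [fin _ _ _] := induced_coloring_card bZ b0.
  split; first exact: image_coloring_coloring.
  by rewrite image_coloring_card //; apply: ideal_coloring_bound.
- by case=> ->; rewrite mul1r.
(* For $(3^6)$ the lattice [Lambda] is [P0] itself, so admissibility selects the factor $2/3$. *)
- by move=> TE; move: La; rewrite TE.
have [fin _ eq_a eq_a36] := induced_coloring_card aZ a0.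
have comp : compatible alpha (induced_coloring T alpha).
  by apply/compatibleP => //; exists 1; rewrite ?mulr1 //; apply: Zadj1.
exists (induced_coloring T alpha); split => //.
- by exists alpha.
- rewrite image_coloring_card //.
  by case: T La eq_a eq_a36 {adm aZ fin comp} => La eq_a eq_a36;
    rewrite ?mul1r; [exact: eq_a|exact: eq_a|exact: eq_a36].
- by move=> h; apply: symmetry_permutes_colors.
Qed.
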